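(* Let $P\ge 2$, $R\ge 1$, and let $\boldsymbol{\mathscr X}\in\mathbb N_0^{N_1\times\cdots\times N_P}$ follow the Poisson canonical polyadic (PCP) model with factor matrices $\mathbf A_p\in\mathbb R_+^{N_p\times R}$ (all entries strictly positive), parameter vector $\boldsymbol\theta=[\mathrm{vec}(\mathbf A_1)^\top\cdots\mathrm{vec}(\mathbf A_P)^\top]^\top$, and parameter tensor $\boldsymbol{\mathscr M}$ with entries $m_{\boldsymbol i}=\sum_{r=1}^R\prod_{p=1}^P\mathbf A_p(i_p,r)$. Let $\boldsymbol a_{k,r}$ denote the $r$-th column of $\mathbf A_k$. Then the observed Fisher information matrix $\mathcal I_{obs}(\boldsymbol\theta,\boldsymbol x)$ and the expected Fisher information matrix $\mathcal I(\boldsymbol\theta)$, both in $\mathbb R^{(R\sum_qN_q)\times(R\sum_qN_q)}$, are $P\times P$ block matrices in which each $(k,l)$ block (of size $RN_k\times RN_l$, $k,l\in[P]$) is itself an $R\times R$ block matrix with $(r,s)$ sub-block of size $N_k\times N_l$ ($r,s\in[R]$), given by $$\mathcal I_{obs}(\boldsymbol\theta,\boldsymbol x)=\Big\{\big\{\mathbf D_{k,l}^{r,s}(\boldsymbol{\mathscr X}\oslash\boldsymbol{\mathscr M}^{*2})+\mathbf F_{k,l}^{r,s}\big\}_{r,s}\Big\}_{k,l},\qquad \mathcal I(\boldsymbol\theta)=\Big\{\big\{\mathbf D_{k,l}^{r,s}(\boldsymbol{\mathscr M}^{*-1})\big\}_{r,s}\Big\}_{k,l},$$ where, for a tensor $\boldsymbol{\mathscr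 Y}$ of the same size as $\boldsymbol{\mathscr X}$, the matrices $\mathbf D_{k,l}^{r,s}(\boldsymbol{\mathscr Y}),\mathbf F_{k,l}^{r,s}\in\mathbb R^{N_k\times N_l}$ are $$\mathbf D_{k,l}^{r,s}(\boldsymbol{\mathscr Y})=\begin{cases}\mathrm{diag}\big(\boldsymbol{\mathscr Y}\bar\times_{q\ne k}(\boldsymbol a_{q,r}*\boldsymbol a_{q,s})\big)&k=l,\\ (\boldsymbol a_{k,s}\boldsymbol a_{l,r}^\top)*\mathbf Y_{(k)}&k\ne l,\ P=2,\\ (\boldsymbol a_{k,s}\boldsymbol a_{l,r}^\top)*\big(\boldsymbol{\mathscr Y}\bar\times_{q\ne k,l}(\boldsymbol a_{q,r}*\boldsymbol a_{q,s})\big)&k<l,\ P>2,\end{cases}$$ $$\mathbf F_{k,l}^{r,s}=\begin{cases}\mathbf 0&k=l\text{ or }r\ne s,\\ \mathbf 1_{N_k}\mathbf 1_{N_l}^\top-(\mathbf X_{(k)}\oslash\mathbf M_{(k)})&k\ne l,\ r=s,\ P=2,\\ \big(\prod_{q\ne k,l}\boldsymbol\lambda_q[r]\big)\mathbf 1_{N_k}\mathbf 1_{N_l}^\top-\big((\boldsymbol{\mathscr X}\oslash\boldsymbol{\mathscr M})\bar\times_{q\ne k,l}(\boldsymbol a_{q,r})\big)&k<l,\ r=s,\ P>2,\end{cases}$$ and, when $P>2$ and $k>l$, $\mathbf D_{k,l}^{r,s}(\boldsymbol{\mathscr Y})=\mathbf D_{l,k}^{s,r}(\boldsymbol{\mathscr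 Y})^\top$ and $\mathbf F_{k,l}^{r,s}=(\mathbf F_{l,k}^{r,s})^\top$.
   Context: PCP model: the entries $x_{\boldsymbol i}$ of $\boldsymbol{\mathscr X}$, $\boldsymbol i=(i_1,\dots,i_P)$ with $i_k\in\{1,\dots,N_k\}$, are independent with $x_{\boldsymbol i}\sim\mathrm{Poisson}(m_{\boldsymbol i})$. $\mathbb R_+$ denotes the positive reals. $\boldsymbol x=\mathrm{vec}(\boldsymbol{\mathscr X})$; $\mathrm{vec}(\mathbf A_p)$ stacks the columns of $\mathbf A_p$. The loglikelihood is $\ell(\boldsymbol x|\boldsymbol\theta)=\sum_{\boldsymbol i}[x_{\boldsymbol i}\log m_{\boldsymbol i}-m_{\boldsymbol i}-\log(x_{\boldsymbol i}!)]$. The observed Fisher information is $\mathcal I_{obs}(\boldsymbol\theta,\boldsymbol x)=-\nabla^2_{\boldsymbol\theta,\boldsymbol\theta}\ell(\boldsymbol x|\boldsymbol\theta)$; the expected Fisher information is $\mathcal I(\boldsymbol\theta)=\mathbb E[\mathcal I_{obs}(\boldsymbol\theta,\boldsymbol x)]$, expectation over $\boldsymbol x$ under the model with parameter $\boldsymbol\theta$. Notation: $[P]=\{1,\dots,P\}$. $*$, $\oslash$ and $(\cdot)^{*k}$ are the entrywise product, division and $k$-th power. $\mathbf 1_n$ is the all-ones vector of length $n$. $\boldsymbol\lambda_q=\mathbf A_q^\top\mathbf 1_{N_q}\in\mathbb R^R$ and $\boldsymbol\lambda_q[r]$ is its $r$-th entry. $\mathbf Y_{(k)}\in\mathbb R^{N_k\times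 N/N_k}$ ($N=\prod_pN_p$) is the mode-$k$ matricization; for $P=2$, $\mathbf Y_{(1)}=\mathbf Y$ and $\mathbf Y_{(2)}=\mathbf Y^\top$. $\boldsymbol{\mathscr Y}\bar\times_{q\ne k}(\boldsymbol b_q)\in\mathbb R^{N_k}$ is the vector obtained by contracting every mode $q\ne k$ of $\boldsymbol{\mathscr Y}$ with $\boldsymbol b_q\in\mathbb R^{N_q}$ (entry $i_k$ is $\sum_{i_q:\,q\ne k}y_{\boldsymbol i}\prod_{q\ne k}\boldsymbol b_q(i_q)$). For $k<l$, $\boldsymbol{\mathscr Y}\bar\times_{q\ne k,l}(\boldsymbol b_q)\in\mathbb R^{N_k\times N_l}$ is the matrix obtained by contracting all modes except $k,l$ in the same way, with rows indexed by mode $k$ and columns by mode $l$. $\{\cdot\}_{k,l}$ and $\{\cdot\}_{r,s}$ denote block matrices with the displayed $(k,l)$ or $(r,s)$ blocks. *)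

(* Defs.v *)
From HB Require Import structures.
From mathcomp Require Import all_boot all_order all_algebra.
From mathcomp Require Import all_classical all_reals all_analysis.

Set Implicit Arguments.
Unset Strict Implicit.
Unset Printing Implicit Defensive.

Import Order.TTheory GRing.Theory Num.Theory.
Import numFieldNormedType.Exports.

Local Open Scope classical_set_scope.
Local Open Scope ring_scope.

(* Modes, indices and columns are numbered from 0; mode k has size N k. *)
Notation multi_index N := {dffun forall k, 'I_(N k)}.

Definition tensor (P : nat) (N : 'I_P -> nat) (S : Type) : Type :=
  multi_index N -> S.

Definition hadamard (K : realType) (m n : nat) (A B : 'M[K]_(m, n)) :
  'M[K]_(m, n) := map2_mx *%R A B.

Definition hadamard_div (K : realType) (m n : nat) (A B : 'M[K]_(m, n)) :
  'M[K]_(m, n) := map2_mx (fun a b => a / b) A B.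

Definition ones (K : realType) (n : nat) : 'cV[K]_n := const_mx 1.

Section tensor_algebra.
Context (K : realType) (P : nat) (N : 'I_P -> nat).
Implicit Type Y : tensor N K.

(* Position of a multi-index among the columns of the mode-k matricization:
   the remaining modes are listed with the lowest one varying fastest. *)
Definition matricization_col (k : 'I_P) (i : multi_index N) : nat :=
  (\sum_(q < P | q != k) i q * \prod_(m < P | (m < q) && (m != k)) N m)%N.

(* The width n stands for \prod_(q | q != k) N q. It is left free so that, when
   P = 2, the matrix has type 'M_(N k, N l) with l the mode other than k. For
   that width each sum below has exactly one term. *)
Definition matricization (k : 'I_P) (n : nat) Y : 'M[K]_(N k, n) :=
  \matrix_(a, c)
    \sum_(i : multi_index N | (i k == a) && (matricization_col k i == c)) Y i.

Definition contract_but1 Y (k : 'I_P) (b : forall q, 'cV[K]_(N q)) :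
  'cV[K]_(N k) :=
  \col_a \sum_(i : multi_index N | i k == a)
    Y i * \prod_(q < P | q != k) b q (i q) 0.

Definition contract_but2 Y (k l : 'I_P) (b : forall q, 'cV[K]_(N q)) :
  'M[K]_(N k, N l) :=
  \matrix_(a, c) \sum_(i : multi_index N | (i k == a) && (i l == c))
    Y i * \prod_(q < P | (q != k) && (q != l)) b q (i q) 0.

End tensor_algebra.

Section pcp.
Context (K : realType) (P R : nat) (N : 'I_P -> nat).
Implicit Type A : forall p : 'I_P, 'M[K]_(N p, R).

(* Equal to R * \sum_p N p, see param_dimE; this form carries the block
   structure of the parameter vector. *)
Definition param_dim : nat := (\sum_(p < P) \sum_(r < R) N p)%N.

Lemma param_dimE : param_dim = (R * \sum_(p < P) N p)%N.
Proof.
rewrite /param_dim big_distrr/=; apply: eq_bigr => p _.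
by rewrite sum_nat_const card_ord.
Qed.

Definition param A : 'cV[K]_param_dim :=
  \mxcol_(p < P) \mxcol_(r < R) col r (A p).

Definition factors (theta : 'cV[K]_param_dim) (p : 'I_P) : 'M[K]_(N p, R) :=
  \matrix_(i, r) submxcol (submxcol theta p) r i 0.

Lemma paramK A p : factors (param A) p = A p.
Proof. by apply/matrixP => i r; rewrite mxE /param !mxcolK mxE. Qed.

Definition mean_tensor A : tensor N K :=
  fun i : multi_index N => \sum_(r < R) \prod_(p < P) A p (i p) r.

Definition loglikelihood (x : tensor N nat) (theta : 'cV[K]_param_dim) : K :=
  let m := mean_tensor (factors theta) in
  \sum_(i : multi_index N) ((x i)%:R * ln (m i) - m i - ln ((x i)`!)%:R).

Section fisher_blocks.
Context (A : forall p : 'I_P, 'M[K]_(N p, R)).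

Definition cp_column (k : 'I_P) (r : 'I_R) : 'cV[K]_(N k) := col r (A k).

Definition column_sums (q : 'I_P) : 'cV[K]_R := (A q)^T *m ones K (N q).

Definition D_upper (Y : tensor N K) (k l : 'I_P) (r s : 'I_R) :
    'M[K]_(N k, N l) :=
  hadamard (cp_column k s *m (cp_column l r)^T)
    (contract_but2 Y k l (fun q => hadamard (cp_column q r) (cp_column q s))).

(* On the diagonal, conform_mx only casts from 'M_(N k) to 'M_(N k, N l). *)
Definition D_block (Y : tensor N K) (k l : 'I_P) (r s : 'I_R) :
    'M[K]_(N k, N l) :=
  if k == l then
    conform_mx 0
      (diag_mx (contract_but1 Y k
        (fun q => hadamard (cp_column q r) (cp_column q s)))^T)
  else if P == 2%N then
    hadamard (cp_column k s *m (cp_column l r)^T) (matricization k (N l) Y)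
  else if (k < l)%N then D_upper Y k l r s
  else (D_upper Y l k s r)^T.

Definition F_upper (X : tensor N K) (k l : 'I_P) (r : 'I_R) :
    'M[K]_(N k, N l) :=
  (\prod_(q < P | (q != k) && (q != l)) column_sums q r 0)
    *: (ones K (N k) *m (ones K (N l))^T)
  - contract_but2 (fun i => X i / mean_tensor A i) k l (fun q => cp_column q r).

Definition F_block (X : tensor N K) (k l : 'I_P) (r s : 'I_R) :
    'M[K]_(N k, N l) :=
  if (k == l) || (r != s) then 0
  else if P == 2%N then
    ones K (N k) *m (ones K (N l))^T
    - hadamard_div (matricization k (N l) X)
        (matricization k (N l) (mean_tensor A))
  else if (k < l)%N then F_upper X k l r
  else (F_upper X l k r)^T.

End fisher_blocks.

Definition blocks (B : forall k l : 'I_P, 'I_R -> 'I_R -> 'M[K]_(N k, N l)) :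
    'M[K]_param_dim :=
  \mxblock_(k < P, l < P) \mxblock_(r < R, s < R) B k l r s.

End pcp.

Section hessian.
Context (K : realType) (n : nat).
Implicit Types (f : 'cV[K]_n -> K) (t : 'cV[K]_n).

Definition hessian f t : 'M[K]_n :=
  \matrix_(i, j) 'D_(delta_mx i 0) ('D_(delta_mx j 0) f) t.

Definition has_hessian f t : Prop :=
  forall i j : 'I_n,
    (\forall u \near t, derivable f u (delta_mx j 0)) /\
    derivable ('D_(delta_mx j 0) f) t (delta_mx i 0).

End hessian.

Definition mutually_independent (d d' : measure_display)
    (T : measurableType d) (T' : measurableType d') (K : realType)
    (Pr : probability T K) (I : finType) (X : I -> {RV Pr >-> T'}) : Prop :=
  forall (J : {set I}) (B : I -> set T'), (forall i, measurable (B i)) ->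
    Pr (\bigcap_(i in [set` J]) X i @^-1` B i) =
    (\prod_(i in J) Pr (X i @^-1` B i))%E.

(* The second argument of poisson_prob is unused by its definition. *)
Definition follows_PCP (d : measure_display) (T : measurableType d)
    (K : realType) (Pr : probability T K) (P R : nat) (N : 'I_P -> nat)
    (A : forall p : 'I_P, 'M[K]_(N p, R))
    (X : multi_index N -> {RV Pr >-> nat}) : Prop :=
  mutually_independent X /\
  forall i, distribution Pr (X i) = poisson_prob (mean_tensor A i) 0.

Definition observed_fisher (K : realType) (P R : nat) (N : 'I_P -> nat)
    (theta : 'cV[K]_(param_dim R N)) (x : tensor N nat) :
    'M[K]_(param_dim R N) :=
  - hessian (loglikelihood x) theta.

(* Equal to I(theta) when X follows the model with parameter theta. *)
Definition expected_fisher (d : measure_display) (T : measurableType d)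
    (K : realType) (Pr : probability T K) (P R : nat) (N : 'I_P -> nat)
    (X : multi_index N -> {RV Pr >-> nat}) (theta : 'cV[K]_(param_dim R N)) :
    'M[K]_(param_dim R N) :=
  \matrix_(a, b) fine 'E_Pr[fun w => observed_fisher theta (X^~ w) a b].

(* Main.v *)
Require Import Defs.
From HB Require Import structures.
From mathcomp Require Import all_boot all_order all_algebra.
From mathcomp Require Import all_classical all_reals all_analysis.
From mathcomp Require Import measurable_realfun.
From mathcomp Require Import ring zify.

Set Implicit Arguments.
Unset Strict Implicit.
Unset Printing Implicit Defensive.

Import Order.TTheory GRing.Theory Num.Theory.
Import numFieldNormedType.Exports.

Local Open Scope classical_set_scope.
Local Open Scope ring_scope.

(** Everything rests on one structural fact: the mean [m_i], a sum over the
    columns [t] of the products [\prod_q A_q(i_q, t)], is affine in each single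
    entry of the factor matrices.  Moving the entry [A_l(c, s)] by [h] adds to
    [m_i] exactly [h] times a slope, the product of the other factors of column
    [s] when [i_l = c] and zero otherwise ([mean_tensor_move]); that slope is in
    turn affine in each entry, and its own slope, the bend, is zero or a product
    over all modes but two ([mean_slope_move]).  So the derivatives of the mean are pure
    algebra, and calculus enters only through [ln] and the inverse.

    The chain rule then gives, for the pair of coordinates [(k, r, a)] and
    [(l, s, c)], the second derivative of the log-likelihood at any positive
    parameter.  Its opposite is

      [\sum_i (x_i / m_i^2 * slope * slope + (1 - x_i / m_i) * bend)]

    ([fisher_entry], [is_derive2_loglikelihood]).  The log-likelihood must be
    differentiated first on a whole neighbourhood of the parameter, which is
    possible because positivity of all the entries is an open condition
    ([near_factors_gt0]).

    Splitting this sum into its two parts yields the two families of blocks: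
    the first part is [D] ([D_blockE]) and the second is [F] ([F_blockE]).  The
    constant [\prod_q \lambda_q(r)] in [F] is the sum of the bends over the
    multi-indices with two prescribed entries, by distributivity
    ([sum_prod_fiber2]).  With two modes such a fibre is a single multi-index,
    so the matricizations are degenerate contractions and the entrywise quotient
    of matricizations is the matricization of the quotient
    ([matricization_two], [F_two]).

    Finally the sum is affine in [x], so its expectation is obtained by
    replacing [x] by its mean, which is [m] since the mean of a Poisson variable
    is its rate ([poisson_mean]).  At [x = m] the factors [1 - x_i / m_i] vanish
    and [m_i / m_i^2] is [m_i^-1] ([fisher_entry_mean]). *)

(** * Directional derivatives *)

(** Restricting to the line through [t] directed by [v] reduces directional
    derivatives to functions of one real variable, and so transports the
    one-variable chain rule. *)
Lemma is_derive_line (K : numFieldType) (V W : normedModType K) (f : V -> W)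
    (t v : V) (df : W) :
  is_derive t v f df <-> is_derive (0 : K) 1 (fun h : K => f (h *: v + t)) df.
Proof.
suff E : (fun h => h^-1 *: ((f \o shift t) (h *: v) - f t)) =
         (fun h : K => h^-1 *: (((fun s : K => f (s *: v + t)) \o shift 0) (h *: 1)
            - f (0 *: v + t))).
  by split=> -[exd vald]; split; move: exd vald; rewrite /derivable /derive E.
by apply/funext => h /=; rewrite addr0 scale0r add0r [_%:A]mulr1.
Qed.

Lemma is_derive_comp_real (K : realType) (V : normedModType K) (f : V -> K)
    (g : K -> K) (t v : V) (df dg : K) :
  is_derive t v f df -> is_derive (f t) 1 g dg ->
  is_derive t v (g \o f) (dg * df).
Proof.
move=> /is_derive_line Df Dg; apply/is_derive_line.
(* The point [t] is the one of parameter 0 on the line. *)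
rewrite -(add0r t) -(scale0r v) in Dg.
exact: (@is_derive1_comp _ g (fun h : K => f (h *: v + t)) 0 dg df).
Qed.

(** Along the line the difference quotient is constant, so that differentiating
    a multi-affine function in a coordinate direction is plain algebra. *)
Lemma is_derive_affine (K : numFieldType) (V W : normedModType K) (f : V -> W)
    (t v : V) (g : W) :
  (forall h : K, f (h *: v + t) = f t + h *: g) -> is_derive t v f g.
Proof.
move=> fE; suff cv : (fun h => h^-1 *: ((f \o shift t) (h *: v) - f t)) @ 0^' --> g.
  by split; [apply/cvg_ex; exists g | exact: cvg_lim cv].
apply: cvg_near_cst; near=> h.
rewrite /= fE addrC addKr scalerA mulVf ?scale1r//.
by near: h; exact: nbhs_dnbhs_neq.
Unshelve. all: by end_near. Qed.

Lemma is_derive_bigsum (K : numFieldType) (V W : normedModType K) (I : finType)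
    (f : I -> V -> W) (t v : V) (df : I -> W) :
  (forall i, is_derive t v (f i) (df i)) ->
  is_derive t v (fun u => \sum_i f i u) (\sum_i df i).
Proof.
move=> Df; rewrite -fct_sumE.
elim/big_ind2 : _ => [|*|i _]; [exact: is_derive_cst|exact: is_deriveD|exact: Df].
Qed.

Section poisson_term.
Context (K : realType) (V : normedModType K) (t v : V).
Implicit Types (x dm dg c : K) (m g : V -> K).

Lemma is_derive_poisson_loglik x c m dm : 0 < m t ->
  is_derive t v m dm ->
  is_derive t v (fun u => x * ln (m u) - m u - c) ((x / m t - 1) * dm).
Proof.
move=> mt0 Dm.
have Dln := is_derive_comp_real Dm (is_derive1_ln mt0).
have D1 := is_deriveZ x Dln.
have D2 := is_deriveB (is_deriveB D1 Dm) (is_derive_cst c t v).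
apply: is_derive_eq D2 _.
by rewrite /GRing.scale/=; ring.
Qed.

Lemma is_derive_poisson_score x m g dm dg : m t != 0 ->
  is_derive t v m dm -> is_derive t v g dg ->
  is_derive t v (fun u => (x / m u - 1) * g u)
    ((x / m t - 1) * dg - x / m t ^+ 2 * (g t * dm)).
Proof.
move=> mt0 Dm Dg.
have Dinv : is_derive t v (fun u => (m u)^-1) (- (m t) ^- 2 *: dm).
  by case: Dm => exm vm; split; [exact: derivableV|rewrite deriveV// vm].
have D1 : is_derive t v (fun u => x / m u - 1) (- (x / m t ^+ 2 * dm)).
  apply: is_derive_eq (is_deriveB (is_deriveZ x Dinv) (is_derive_cst (1 : K) t v)) _.
  by rewrite /GRing.scale/=; field.
by apply: is_derive_eq (is_deriveM D1 Dg) _; rewrite /GRing.scale/=; field.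
Qed.

End poisson_term.

(** * Log-likelihood: first and second derivatives *)

Section parameter_index.
Context (K : realType) (P R : nat) (N : 'I_P -> nat).
Local Notation dim := (param_dim R N).

(** The position in the parameter vector of the entry in row [a] and column [r]
    of the factor matrix of mode [p]. *)
Definition param_index (p : 'I_P) (r : 'I_R) (a : 'I_(N p)) : 'I_dim :=
  @tagnat.Rank P (fun p => (\sum_(r < R) N p)%N) p
    (@tagnat.Rank R (fun=> N p) r a).

Lemma param_indexP (Q : 'I_dim -> Prop) :
  (forall p r (a : 'I_(N p)), Q (param_index r a)) -> forall j, Q j.
Proof.
move=> Qidx j; rewrite -(tagnat.sig2K j) -(tagnat.sig2K (tagnat.sig2 j)).
exact: Qidx.
Qed.

Lemma eq_param_index p q r s (a : 'I_(N p)) (b : 'I_(N q)) :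
  (param_index r a == param_index s b) =
    [&& p == q, r == s & a == b :> nat].
Proof.
rewrite -val_eqE tagnat.eq_Rank; case: eqVneq b => [<- b|//].
by rewrite tagnat.eq_Rank.
Qed.

Lemma factorsE (theta : 'cV[K]_dim) p a r :
  factors theta p a r = theta (param_index r a) 0.
Proof. by rewrite !mxE. Qed.

Lemma blocksE (B : forall k l : 'I_P, 'I_R -> 'I_R -> 'M[K]_(N k, N l))
    k l r s (a : 'I_(N k)) (c : 'I_(N l)) :
  blocks B (param_index r a) (param_index s c) = B k l r s a c.
Proof.
have := mxblockK (fun k l => \mxblock_(r < R, s < R) B k l r s) k l.
move=> /matrixP/(_ (@tagnat.Rank R (fun=> N k) r a) (@tagnat.Rank R (fun=> N l) s c)).
rewrite mxE => ->.
by have /matrixP/(_ a c) := mxblockK (fun r s => B k l r s) r s; rewrite mxE => ->.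
Qed.

Definition param_dir (l : 'I_P) (s : 'I_R) (c : 'I_(N l)) : 'cV[K]_dim :=
  delta_mx (param_index s c) 0.

Lemma factors_move (theta : 'cV[K]_dim) (h : K) l s (c : 'I_(N l)) q i t :
  factors (h *: param_dir s c + theta) q i t =
    factors theta q i t + h * [&& q == l, t == s & i == c :> nat]%:R.
Proof.
by rewrite !factorsE !mxE eq_param_index andbT addrC.
Qed.

End parameter_index.

Section derivatives.
Context (K : realType) (P R : nat) (N : 'I_P -> nat).
Local Notation dim := (param_dim R N).
Implicit Types (A : forall p, 'M[K]_(N p, R)) (theta : 'cV[K]_dim).

Definition term_over A (i : multi_index N) (t : 'I_R) (S : pred 'I_P) : K :=
  \prod_(q < P | S q) A q (i q) t.

(** The coordinate [(l, s, c)] occurs at most once as a factor of the product,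
    which is therefore affine in it.  Keeping the set [S] of modes arbitrary lets
    the same computation serve for the mean and for its slope. *)
Lemma term_over_move theta (h : K) l s (c : 'I_(N l)) i t S :
  term_over (factors (h *: param_dir K s c + theta)) i t S =
  term_over (factors theta) i t S +
  h * ([&& S l, t == s & i l == c]%:R *
       term_over (factors theta) i t [pred q | S q && (q != l)]).
Proof.
rewrite /term_over; have off q : q != l ->
    factors (h *: param_dir K s c + theta) q (i q) t = factors theta q (i q) t.
  by move=> /negPf ql; rewrite factors_move ql mulr0 addr0.
have [Sl|nSl] /= := boolP (S l); last first.
  rewrite mul0r mulr0 addr0; apply: eq_bigr => q Sq; apply: off.
  by apply: contraNneq nSl => <-.
rewrite (bigD1 l Sl) [X in _ = X + _](bigD1 l Sl) /= factors_move eqxx /=.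
rewrite (eq_bigr (fun q => factors theta q (i q) t)) => [|q /andP[_ /off->//]].
by rewrite mulrDl mulrA.
Qed.

(** The partial derivative of the mean [m_i] with respect to the coordinate
    [(l, s, c)]. *)
Definition mean_slope A l (s : 'I_R) (c : 'I_(N l)) (i : multi_index N) : K :=
  (i l == c)%:R * term_over A i s (predC1 l).

(** The mixed second partial derivative of [m_i] with respect to the coordinates
    [(k, r, a)] and [(l, s, c)].  It vanishes for [k = l] because no product
    contains two entries of the same factor matrix. *)
Definition mean_bend A k (r : 'I_R) (a : 'I_(N k)) l (s : 'I_R) (c : 'I_(N l))
    (i : multi_index N) : K :=
  [&& k != l, r == s, i k == a & i l == c]%:R *
  term_over A i r [pred q | (q != k) && (q != l)].

Lemma mean_tensor_move theta (h : K) l s (c : 'I_(N l)) i :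
  mean_tensor (factors (h *: param_dir K s c + theta)) i =
  mean_tensor (factors theta) i + h * mean_slope (factors theta) s c i.
Proof.
rewrite /mean_tensor (eq_bigr _ (fun t _ => term_over_move theta h s c i t predT)).
rewrite big_split/= -mulr_sumr; congr (_ + _ * _).
rewrite (bigD1 s)//= eqxx big1 ?addr0// => t /negPf ->.
by rewrite mul0r.
Qed.

Lemma mean_slope_move theta (h : K) k r (a : 'I_(N k)) l s (c : 'I_(N l)) i :
  mean_slope (factors (h *: param_dir K r a + theta)) s c i =
  mean_slope (factors theta) s c i + h * mean_bend (factors theta) r a s c i.
Proof.
rewrite /mean_slope /mean_bend term_over_move/= mulrDr mulrCA.
congr (_ + h * _).
have [->|sr] := eqVneq r s; last by rewrite /= andbF !mul0r mulr0.
rewrite /= mulrA -natrM mulnb [(i l == c) && _]andbC -!andbA.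
congr (_ * _); apply: eq_bigl => q /=; exact: andbC.
Qed.

Lemma is_derive_mean theta l s (c : 'I_(N l)) i :
  is_derive theta (param_dir K s c) (fun u => mean_tensor (factors u) i)
    (mean_slope (factors theta) s c i).
Proof. by apply: is_derive_affine => h; exact: mean_tensor_move. Qed.

Lemma is_derive_mean_slope theta k r (a : 'I_(N k)) l s (c : 'I_(N l)) i :
  is_derive theta (param_dir K r a) (fun u => mean_slope (factors u) s c i)
    (mean_bend (factors theta) r a s c i).
Proof. by apply: is_derive_affine => h; exact: mean_slope_move. Qed.

Lemma mean_tensor_gt0 A i : (0 < R)%N -> (forall p a r, 0 < A p a r) ->
  0 < mean_tensor A i.
Proof.
move=> R0 A0; rewrite /mean_tensor (bigD1 (Ordinal R0))//=.
rewrite ltr_pwDl//; first by apply: prodr_gt0.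
by apply: sumr_ge0 => r _; apply: prodr_ge0 => p _; exact: ltW.
Qed.

(** [ln] is differentiable at positive arguments only; the second derivative
    needs the first one on a whole neighbourhood, which this provides. *)
Lemma near_factors_gt0 theta : (forall p a r, 0 < factors theta p a r) ->
  \forall u \near theta, forall p a r, 0 < factors u p a r.
Proof.
move=> theta0.
have : \forall u \near theta, forall j : 'I_dim, 0 < (u : 'cV[K]_dim) j 0.
  apply: (@filter_forall _ _ (fun j (u : 'cV[K]_dim) => 0 < u j 0) (nbhs theta) _).
  apply: param_indexP => p r a.
  have /cvgr_gt := @coord_continuous K _ _ (param_index r a) 0 theta.
  by apply; rewrite -factorsE.
by apply: filterS => u u0 p a r; rewrite factorsE.
Qed.

Definition score (x : tensor N nat) l (s : 'I_R) (c : 'I_(N l)) theta : K :=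
  \sum_i ((x i)%:R / mean_tensor (factors theta) i - 1) *
         mean_slope (factors theta) s c i.

Lemma is_derive_loglikelihood x theta l s (c : 'I_(N l)) : (0 < R)%N ->
  (forall p a r, 0 < factors theta p a r) ->
  is_derive theta (param_dir K s c) (loglikelihood x) (score x s c theta).
Proof.
move=> R0 theta0; apply: is_derive_bigsum => i.
apply: is_derive_poisson_loglik; first exact: mean_tensor_gt0.
exact: is_derive_mean.
Qed.

Lemma is_derive_score x theta k r (a : 'I_(N k)) l s (c : 'I_(N l)) :
  (0 < R)%N -> (forall p a r, 0 < factors theta p a r) ->
  is_derive theta (param_dir K r a) (score x s c)
    (\sum_i (((x i)%:R / mean_tensor (factors theta) i - 1) *
               mean_bend (factors theta) r a s c i -
             (x i)%:R / mean_tensor (factors theta) i ^+ 2 *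
               (mean_slope (factors theta) s c i *
                mean_slope (factors theta) r a i))).
Proof.
move=> R0 theta0; apply: is_derive_bigsum => i.
apply: is_derive_poisson_score.
- by rewrite gt_eqF// mean_tensor_gt0.
- exact: is_derive_mean.
- exact: is_derive_mean_slope.
Qed.

(** The common closed form of the entries of both information matrices: the
    observed one is its value at [y = x], the expected one at the mean of [x]. *)
Definition fisher_entry A (y : tensor N K) k r (a : 'I_(N k)) l s (c : 'I_(N l)) : K :=
  \sum_i (y i / mean_tensor A i ^+ 2 * (mean_slope A r a i * mean_slope A s c i) +
          (1 - y i / mean_tensor A i) * mean_bend A r a s c i).

(** Isolates the dependence on the data, for the passage to expectations. *)
Lemma fisher_entry_affine A (y : tensor N K) k r (a : 'I_(N k)) l s (c : 'I_(N l)) :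
  fisher_entry A y r a s c =
  \sum_i ((mean_slope A r a i * mean_slope A s c i / mean_tensor A i ^+ 2 -
            mean_bend A r a s c i / mean_tensor A i) * y i + mean_bend A r a s c i).
Proof. by apply: eq_bigr => i _; ring. Qed.

Lemma is_derive2_loglikelihood x theta k r (a : 'I_(N k)) l s (c : 'I_(N l)) :
  (0 < R)%N -> (forall p a r, 0 < factors theta p a r) ->
  is_derive theta (param_dir K r a) ('D_(param_dir K s c) (loglikelihood x))
    (- fisher_entry (factors theta) (fun i => (x i)%:R) r a s c).
Proof.
move=> R0 theta0.
apply: (@near_eq_is_derive _ _ _ (score x s c)).
  move: (near_factors_gt0 theta0); apply: filterS => u u0.
  by rewrite (derive_val (is_derive := is_derive_loglikelihood x s c R0 u0)).
apply: is_derive_eq (is_derive_score x r a s c R0 theta0) _.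
rewrite /fisher_entry -sumrN; apply: eq_bigr => i _; ring.
Qed.

Lemma has_hessian_loglikelihood x A : (0 < R)%N -> (forall p a r, 0 < A p a r) ->
  has_hessian (loglikelihood x) (param A).
Proof.
move=> R0 A0; have p0 p a r : 0 < factors (param A) p a r by rewrite paramK.
apply: param_indexP => k r a; apply: param_indexP => l s c; split.
  move: (near_factors_gt0 p0); apply: filterS => u u0.
  by have [] := is_derive_loglikelihood x s c R0 u0.
by have [] := is_derive2_loglikelihood x r a s c R0 p0.
Qed.

Lemma observed_fisherE x A k r (a : 'I_(N k)) l s (c : 'I_(N l)) :
  (0 < R)%N -> (forall p a r, 0 < A p a r) ->
  observed_fisher (param A) x (param_index r a) (param_index s c) =
  fisher_entry A (fun i => (x i)%:R) r a s c.
Proof.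
move=> R0 A0; have p0 p a' r' : 0 < factors (param A) p a' r' by rewrite paramK.
have AE : factors (param A) = A by apply/functional_extensionality_dep/paramK.
rewrite !mxE (derive_val (is_derive := is_derive2_loglikelihood x r a s c R0 p0)).
by rewrite opprK AE.
Qed.

End derivatives.

(** * Closed form of the blocks *)

Section multi_index_sums.
Context (K : comNzRingType) (P : nat) (N : 'I_P -> nat).

(** Distributivity, for factors whose index types vary with the mode. *)
Lemma sum_prod_multi_index (F : forall q, 'I_(N q) -> K) :
  \sum_(i : multi_index N) \prod_q F q (i q) = \prod_q \sum_x F q x.
Proof.
pose G q := [ffun x => F q x].
transitivity (\prod_q \sum_x G q x); last first.
  by apply: eq_bigr => q _; apply: eq_bigr => x _; rewrite ffunE.
rewrite (eq_bigr _ (fun q _ => big_tag (fun q => G q : _ -> _) q)).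
rewrite bigA_distr_big_dep -big_fprod (reindex (@dffun_of_fprod _ _)); last first.
  exact/onW_bij/dffun_of_fprod_bij.
by apply: eq_bigr => i _; apply: eq_bigr => q _; rewrite !ffunE.
Qed.

(** A constraint [i k = a] amounts to inserting in the product an indicator
    factor at mode [k], whose own sum is 1; so the constrained sum is an instance
    of distributivity over all the modes. *)
Lemma sum_prod_fiber2 (k l : 'I_P) (a : 'I_(N k)) (c : 'I_(N l))
    (b : forall q, 'I_(N q) -> K) : k != l ->
  \sum_(i : multi_index N | (i k == a) && (i l == c))
    \prod_(q < P | (q != k) && (q != l)) b q (i q) =
  \prod_(q < P | (q != k) && (q != l)) \sum_x b q x.
Proof.
move=> kl; pose F q (x : 'I_(N q)) : K :=
  if q == k then (x == a :> nat)%:R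
  else if q == l then (x == c :> nat)%:R else b q x.
have Fk x : F k x = (x == a)%:R by rewrite /F eqxx.
have Fl x : F l x = (x == c)%:R by rewrite /F eq_sym (negPf kl) eqxx.
have Fo q : (q != k) && (q != l) -> F q = b q.
  by rewrite /F => /andP[/negPf-> /negPf->].
have lk : l != k by rewrite eq_sym.
have sum1 n (j : 'I_n) : \sum_(x < n) (x == j)%:R = 1 :> K.
  by rewrite (bigD1 j)//= eqxx big1 ?addr0// => x /negPf->.
have := sum_prod_multi_index F.
rewrite [in RHS](bigD1 k)//= [in RHS](bigD1 l)//=.
rewrite (eq_bigr _ (fun x _ => Fk x)) (eq_bigr _ (fun x _ => Fl x)) !sum1 !mul1r.
rewrite [in RHS](eq_bigr (fun q => \sum_x b q x)); last first.
  by move=> q /Fo Fq; apply: eq_bigr => x _; rewrite Fq.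
move=> <-; rewrite big_mkcond/=; apply: eq_bigr => i _.
rewrite [in RHS](bigD1 k)//= [in RHS](bigD1 l)//= Fk Fl.
rewrite mulrA -natrM mulnb; case: ifP => _; rewrite ?mul0r// mul1r.
by apply: eq_bigr => q /Fo ->.
Qed.

End multi_index_sums.

Section two_modes.
Context (K : realType) (P : nat) (N : 'I_P -> nat).
Context (P2 : P = 2%N) (k l : 'I_P) (kl : k != l).

Lemma mode_of_two q : (q == k) || (q == l).
Proof.
move: kl; rewrite -!val_eqE /=.
have := ltn_ord k; have := ltn_ord l; have := ltn_ord q; lia.
Qed.

Lemma no_third_mode q : (q != k) && (q != l) = false.
Proof. by rewrite -negb_or mode_of_two. Qed.

Lemma matricization_col_two (i : multi_index N) :
  matricization_col k i = i l :> nat.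
Proof.
have lk : l != k by rewrite eq_sym.
rewrite /matricization_col (bigD1 l)//= [X in (_ + X)%N]big_pred0 => [|q]; last first.
  exact: no_third_mode.
rewrite big_pred0 ?muln1 ?addn0// => m.
have /orP[/eqP->|/eqP->] := mode_of_two m; first by rewrite eqxx andbF.
by rewrite ltnn.
Qed.

(** Existence comes from counting: the fibre sum of the constant 1 is an empty
    product, hence 1, so the fibre is not empty.  Uniqueness holds because the
    two prescribed entries are all the entries. *)
Lemma fiber_of_two (a : 'I_(N k)) (c : 'I_(N l)) :
  exists i0 : multi_index N,
    (fun i : multi_index N => (i k == a) && (i l == c)) =1 pred1 i0.
Proof.
have [i0 /andP[/eqP i0k /eqP i0l]] :
    exists i0 : multi_index N, (i0 k == a) && (i0 l == c).
  apply/existsP; apply: contraT; rewrite negb_exists => /forallP none.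
  have := sum_prod_fiber2 a c (fun _ _ => 1%:R : int) kl.
  (* An empty fibre would turn this equation into 0 = 1. *)
  rewrite big_pred0 => [|i]; last by apply/negbTE; exact: (none i).
  by rewrite big_pred0 => // q; exact: no_third_mode.
exists i0 => i /=; apply/andP/eqP => [[/eqP ik /eqP il]|->]; last by rewrite i0k i0l.
by apply/ffunP => q; have /orP[/eqP->|/eqP->] := mode_of_two q; rewrite ?i0k ?i0l.
Qed.

(** Makes the case of two modes an instance of the general one; the vectors [b]
    are arbitrary since no mode is left to contract. *)
Lemma matricization_two (Y : tensor N K) (b : forall q, 'cV[K]_(N q)) :
  matricization k (N l) Y = contract_but2 Y k l b.
Proof.
apply/matrixP => a c; rewrite !mxE; apply: eq_big => [i|i _].
  by rewrite matricization_col_two.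
by rewrite big_pred0 ?mulr1// => q; exact: no_third_mode.
Qed.

End two_modes.

Section fisher_blocks.
Context (K : realType) (P R : nat) (N : 'I_P -> nat).
Context (A : forall p, 'M[K]_(N p, R)).

Lemma term_over_split i t (k l : 'I_P) : k != l ->
  term_over A i t (predC1 k) =
  A l (i l) t * term_over A i t [pred q | (q != k) && (q != l)].
Proof. by move=> kl; rewrite /term_over (bigD1 l)//= eq_sym. Qed.

(** The entries [A_k(a, s)] and [A_l(c, r)] in front of the contraction are
    the two factors that the slopes keep beyond the modes other than [k] and [l]:
    the slope at [(k, r, a)] omits mode [k] only, hence contains [A_l(c, r)]. *)
Lemma D_upperE (Y : tensor N K) (k l : 'I_P) r s (a : 'I_(N k)) (c : 'I_(N l)) :
  k != l ->
  D_upper A Y k l r s a c =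
    \sum_i Y i * (mean_slope A r a i * mean_slope A s c i).
Proof.
move=> kl; rewrite !mxE big_ord1 !mxE mulr_sumr big_mkcond/=.
apply: eq_bigr => i _; rewrite /mean_slope.
have [<-|_] := eqVneq (i k) a; last by rewrite !mul0r mulr0.
have [<-|_] := eqVneq (i l) c; last by rewrite !mul0r !mulr0.
have lk : l != k by rewrite eq_sym.
rewrite /= !mul1r (term_over_split i r kl) (term_over_split i s lk).
under eq_bigr => q _ do rewrite !mxE.
rewrite big_split/= /term_over.
rewrite [X in _ = _ * (_ * (_ * X))](eq_bigl [pred q | (q != k) && (q != l)]); last first.
  by move=> q /=; rewrite andbC.
by rewrite mulrCA -!mulrA; ring.
Qed.

(** For [k = l] the slopes require [i k = a] and [i k = c], whence the diagonal
    matrix; for [k > l] the product of the two slopes is symmetric, whence the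
    transposition. *)
Lemma D_blockE (Y : tensor N K) (k l : 'I_P) r s (a : 'I_(N k)) (c : 'I_(N l)) :
  D_block A Y k l r s a c =
    \sum_i Y i * (mean_slope A r a i * mean_slope A s c i).
Proof.
rewrite /D_block; case: eqVneq c => [<- c|kl c].
  rewrite conform_mx_id !mxE; have [<-|ac] := eqVneq a c; last first.
    rewrite mulr0n big1// => i _; rewrite /mean_slope.
    have [->|_] := eqVneq (i k) a; last by rewrite !mul0r mulr0.
    by rewrite (negPf ac) !mul0r !mulr0.
  rewrite mulr1n big_mkcond/=; apply: eq_bigr => i _; rewrite /mean_slope.
  case: eqVneq => _; last by rewrite !mul0r mulr0.
  rewrite !mul1r /term_over -big_split/=; congr (_ * _).
  by apply: eq_bigr => q _; rewrite !mxE.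
have lk : l != k by rewrite eq_sym.
case: (eqVneq P 2%N) => [P2|_].
  by rewrite -D_upperE// /D_upper -(matricization_two P2 kl).
case: ifP => _; first exact: D_upperE.
rewrite mxE D_upperE//; apply: eq_bigr => i _.
by rewrite [X in _ * X]mulrC.
Qed.

Lemma F_upperE (y : tensor N K) (k l : 'I_P) r (a : 'I_(N k)) (c : 'I_(N l)) :
  k != l ->
  F_upper A y k l r a c =
    \sum_i (1 - y i / mean_tensor A i) * mean_bend A r a r c i.
Proof.
move=> kl; rewrite !mxE big_ord1 !mxE !mulr1.
under [X in X - _]eq_bigr => q _.
  rewrite mxE; under eq_bigr => x _ do rewrite !mxE mulr1. over.
rewrite /= -(sum_prod_fiber2 a c (fun q x => A q x r) kl) -sumrB big_mkcond/=.
apply: eq_bigr => i _; rewrite /mean_bend kl eqxx/=.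
case: ifP => _; last by rewrite mul0r mulr0.
under [X in _ - _ * X]eq_bigr => q _ do rewrite mxE.
by rewrite /term_over/=; ring.
Qed.

(** Entrywise quotient and matricization commute here because each entry of
    the matricization is a sum with a single term. *)
Lemma F_two (y : tensor N K) (k l : 'I_P) r : P = 2%N -> k != l ->
  ones K (N k) *m (ones K (N l))^T
    - hadamard_div (matricization k (N l) y)
        (matricization k (N l) (mean_tensor A)) = F_upper A y k l r.
Proof.
move=> P2 kl; apply/matrixP => a c.
have [i0 fib] := fiber_of_two P2 kl a c.
have colE : (fun i : multi_index N => (i k == a) && (matricization_col k i == c))
    =1 pred1 i0.
  by move=> i; rewrite (matricization_col_two P2 kl); exact: fib.
have noq := no_third_mode P2 kl.
rewrite !mxE !(big_pred1 i0)// !(big_pred0 _ _ _ _ noq) !big_ord1 !mxE.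
by rewrite !mulr1.
Qed.

Lemma F_blockE (y : tensor N K) (k l : 'I_P) r s (a : 'I_(N k)) (c : 'I_(N l)) :
  F_block A y k l r s a c =
    \sum_i (1 - y i / mean_tensor A i) * mean_bend A r a s c i.
Proof.
rewrite /F_block; case: (boolP (k == l)) => [kl|kl] /=.
  by rewrite mxE big1// => i _; rewrite /mean_bend kl mul0r mulr0.
have [<-|rs]/= := eqVneq r s; last first.
  by rewrite mxE big1// => i _; rewrite /mean_bend (negPf rs) andbF mul0r mulr0.
have lk : l != k by rewrite eq_sym.
case: (eqVneq P 2%N) => [P2|_]; first by rewrite (F_two y r P2 kl) F_upperE.
case: ifP => _; first exact: F_upperE.
rewrite mxE F_upperE//; apply: eq_bigr => i _; congr (_ * _).
rewrite /mean_bend kl lk /= [(i l == c) && _]andbC; congr (_ * _).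
by apply: eq_bigl => q /=; exact: andbC.
Qed.

Lemma fisher_entryE (y : tensor N K) (k l : 'I_P) r s (a : 'I_(N k)) (c : 'I_(N l)) :
  fisher_entry A y r a s c =
  (D_block A (fun i => y i / mean_tensor A i ^+ 2) k l r s +
   F_block A y k l r s) a c.
Proof. by rewrite mxE D_blockE F_blockE -big_split. Qed.

(** At [y = m] the factor [1 - y_i / m_i] vanishes, which removes [F]. *)
Lemma fisher_entry_mean (k l : 'I_P) r s (a : 'I_(N k)) (c : 'I_(N l)) :
  (forall i, mean_tensor A i != 0) ->
  fisher_entry A (mean_tensor A) r a s c =
  D_block A (fun i => (mean_tensor A i)^-1) k l r s a c.
Proof.
move=> m0; rewrite D_blockE; apply: eq_bigr => i _.
by field.
Qed.

End fisher_blocks.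

(** * Poisson variables and expectations *)

Section poisson_mean.
Context (K : realType).
Local Open Scope ereal_scope.

Lemma ge0_integral_nat (mu : {measure set nat -> \bar K}) (f : nat -> \bar K) :
  (forall n, 0 <= f n) ->
  \int[mu]_n f n = \sum_(n <oo) f n * mu [set n].
Proof.
move=> f0.
have <- : \bigcup_n [set n : nat] = setT.
  by apply/seteqP; split=> // n _; exists n.
rewrite ge0_integral_bigcup//=; last by move=> i j _ _ [x [/= -> ->]].
apply: eq_eseriesr => n _.
rewrite -integral_cst//; apply: eq_integral => m.
by rewrite inE/= => ->.
Qed.

Lemma poisson_prob_set1 (rate : K) k n : (0 < rate)%R ->
  poisson_prob rate k [set n] = (poisson_pmf rate n)%:E.
Proof.
by move=> r0; rewrite /poisson_prob r0 esum_set1// lee_fin poisson_pmf_ge0.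
Qed.

Lemma poisson_pmfS (rate : K) n : (0 < rate)%R ->
  (n.+1%:R * poisson_pmf rate n.+1 = rate * poisson_pmf rate n)%R.
Proof.
move=> r0; rewrite /poisson_pmf r0 factS natrM exprS.
have nz : (n.+1%:R != 0 :> K)%R by rewrite pnatr_eq0.
have fz : (n`!%:R != 0 :> K)%R by rewrite pnatr_eq0 -lt0n fact_gt0.
by field; apply/andP.
Qed.

Lemma poisson_pmf_sum1 (rate : K) : (0 < rate)%R ->
  \sum_(n <oo) (poisson_pmf rate n)%:E = 1.
Proof.
move=> r0; rewrite -(@probability_setT _ _ _ (poisson_prob rate 0)).
rewrite /= /poisson_prob r0 nneseries_esumT// => n.
by rewrite lee_fin poisson_pmf_ge0.
Qed.

(** Since [(n + 1) p(n + 1) = rate * p(n)], shifting the series of the mean by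
    one turns it into [rate] times the total mass. *)
Lemma poisson_mean (rate : K) k : (0 < rate)%R ->
  \int[poisson_prob rate k]_n (n%:R)%:E = rate%:E.
Proof.
move=> r0; rewrite ge0_integral_nat//.
under eq_eseriesr => n _ do rewrite [X in _ * X]poisson_prob_set1// -EFinM.
have ge0 n : 0 <= (n%:R * poisson_pmf rate n)%:E.
  by rewrite lee_fin mulr_ge0// poisson_pmf_ge0.
rewrite nneseries_recl// mul0r add0e -(nneseries_addn 1)//.
under eq_eseriesr => n _ do rewrite addn1 poisson_pmfS// EFinM.
rewrite nneseriesZl; last by move=> n _; rewrite lee_fin poisson_pmf_ge0.
by rewrite poisson_pmf_sum1// mule1.
Qed.

Context d (T : measurableType d) (Pr : probability T K) (X : {RV Pr >-> nat}).
Context (rate : K) (k : nat) (rate0 : (0 < rate)%R).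
Hypothesis XP : distribution Pr X = poisson_prob rate k.

Lemma poisson_rv_mean : \int[Pr]_w ((X w)%:R)%:E = rate%:E.
Proof.
have <- := ge0_integral_distribution X (f := fun n : nat => (n%:R : K)%:E).
- rewrite -(poisson_mean k rate0); apply: eq_measure_integral => A mA _.
  by rewrite /= XP.
- by [].
- by [].
Qed.

Lemma poisson_rv_integrable : Pr.-integrable setT (fun w => ((X w)%:R : K)%:E).
Proof.
apply/integrableP; split.
  apply/measurable_EFinP.
  exact: (@measurableT_comp _ _ _ _ _ _ (fun n : nat => n%:R : K) _ X).
under eq_integral do rewrite gee0_abs//.
by rewrite poisson_rv_mean ltry.
Qed.

End poisson_mean.

Section affine_expectation.
Context (K : realType) d (T : measurableType d) (Pr : probability T K).
Context (I : finType) (Z : I -> T -> K) (u v : I -> K).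
Hypothesis intZ : forall i, Pr.-integrable setT (fun w => (Z i w)%:E).
Local Open Scope ereal_scope.

Let term i w := (u i)%:E * (Z i w)%:E + (v i)%:E.

Let affineE : (fun w => (\sum_i (u i * Z i w + v i))%R%:E) = (fun w => \sum_i term i w).
Proof. by apply/funext => w; rewrite -sumEFin. Qed.

Let int_cst i : Pr.-integrable setT (fun=> (v i)%:E).
Proof. exact: finite_measure_integrable_cst. Qed.

Let int_scaled i : Pr.-integrable setT (fun w => (u i)%:E * (Z i w)%:E).
Proof. exact: integrableZl. Qed.

Let int_term i : Pr.-integrable setT (term i).
Proof. exact: integrableD. Qed.

Lemma integrable_affine :
  Pr.-integrable setT (fun w => (\sum_i (u i * Z i w + v i))%R%:E).
Proof. by rewrite affineE; apply: integrable_sum. Qed.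

Lemma expectation_affine (m : I -> K) :
  (forall i, \int[Pr]_w (Z i w)%:E = (m i)%:E) ->
  'E_Pr[fun w => (\sum_i (u i * Z i w + v i))%R] =
    (\sum_i (u i * m i + v i))%R%:E.
Proof.
move=> Zm; rewrite unlock affineE integral_sum// -sumEFin.
apply: eq_bigr => i _.
rewrite integralD// integralZl// Zm integral_cst//.
by rewrite -[X in _ + _ * X]/(Pr setT) probability_setT mule1.
Qed.

End affine_expectation.

Theorem theorem3 (K : realType) (P R : nat) (hP : (2 <= P)%N) (hR : (1 <= R)%N)
    (N : 'I_P -> nat) (A : forall p : 'I_P, 'M[K]_(N p, R))
    (hA : forall p i r, 0 < A p i r)
    (d : measure_display) (T : measurableType d) (Pr : probability T K)
    (X : multi_index N -> {RV Pr >-> nat}) (hX : follows_PCP A X) :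
  let M := mean_tensor A in
  (forall x : tensor N nat,
      has_hessian (loglikelihood x) (param A) /\
      observed_fisher (param A) x =
        blocks (fun k l r s =>
          D_block A (fun i => (x i)%:R / M i ^+ 2) k l r s
          + F_block A (fun i => (x i)%:R) k l r s)) /\
  ((forall a b, Pr.-integrable setT
      (fun w => (observed_fisher (param A) (X^~ w) a b)%:E)) /\
   expected_fisher X (param A) =
     blocks (fun k l r s => D_block A (fun i => (M i)^-1) k l r s)).
Proof.
move=> M; have M0 i : 0 < M i by exact: mean_tensor_gt0.
have [_ XP] := hX.
have intX i := poisson_rv_integrable (M0 i) (XP i).
have meanX i := poisson_rv_mean (M0 i) (XP i).
split=> [x|]; [split|split].
- exact: has_hessian_loglikelihood.
- apply/matrixP; apply: param_indexP => k r a; apply: param_indexP => l s c.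
  by rewrite observed_fisherE// fisher_entryE blocksE.
- apply: param_indexP => k r a; apply: param_indexP => l s c.
  under eq_fun do rewrite observed_fisherE// fisher_entry_affine.
  exact: integrable_affine.
- apply/matrixP; apply: param_indexP => k r a; apply: param_indexP => l s c.
  rewrite mxE blocksE -fisher_entry_mean => [|i]; last by rewrite gt_eqF.
  rewrite fisher_entry_affine -[RHS]/(fine _%:E); congr fine.
  rewrite -(expectation_affine _ _ intX meanX); congr ('E_Pr[_])%E.
  by apply/funext => w; rewrite observed_fisherE// fisher_entry_affine.
Qed.
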